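(* Let $A$ be a finite abelian group. For every $g=(T,\lambda_g)\in C(A)$, the restriction $\ell_g:=\lambda_g|_{F_T}$ belongs to $\widehat{F_T}$ (i.e. is a character of the group $F_T$). Moreover, the assignment $(T,\lambda_g)\mapsto(T,\ell_g)$ induces a canonical bijection $$C(A)/\!\sim_{\mathrm{conj}}\ \xrightarrow{\ \sim\ }\ \mathrm{Sp}(V_A)\backslash\mathcal{X}_A$$ from the set of conjugacy classes of $C(A)$ to the set of $\mathrm{Sp}(V_A)$-orbits on $\mathcal{X}_A$.
   Context: **Setting.** $A$ is a finite abelian group, written additively; $\widehat{A}=\mathrm{Hom}(A,U(1))$; $V_A=A\oplus\widehat{A}$ (written additively). Put $\beta_A((a,\chi),(b,\psi))=\chi(b)$ and $\omega_A(u,v)=\beta_A(u,v)\beta_A(v,u)^{-1}$; $\mathrm{Sp}(V_A)=\{T\in\mathrm{Aut}(V_A):\omega_A(Tu,Tv)=\omega_A(u,v)\ \forall u,v\}$. **Projective Clifford group.** Let $\mathcal{H}=\mathbb{C}[A]$ with orthonormal basis $|b\rangle$, $b\in A$; for $v=(a,\chi)\in V_A$ let $W_v|b\rangle=\chi(b)|a+b\rangle$; $H(A)=\{zW_v:z\in U(1),v\in V_A\}$ and $C(A)=N_{U(\mathcal{H})}(H(A))/(U(1)\cdot I)$. Throughout, $C(A)$ is identified (by a known isomorphism) with the group of pairs $(T,\lambda)$, $T\in\mathrm{Aut}(V_A)$, $\lambda:V_A\to U(1)$ a function, satisfying $\lambda(u+v)\lambda(u)^{-1}\lambda(v)^{-1}=\beta_A(Tu,Tv)\beta_A(u,v)^{-1}$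 for all $u,v$, with product $(T,\lambda)(S,\mu)=(TS,\lambda^S\mu)$, $\lambda^S(u)=\lambda(Su)$; $(T,\lambda)$ corresponds to the class of any unitary $U$ with $UW_uU^\dagger=\lambda(u)W_{Tu}$ for all $u$. Necessarily $T\in\mathrm{Sp}(V_A)$, and the projection $(T,\lambda)\mapsto T$ is onto $\mathrm{Sp}(V_A)$ (known). **Notation.** For $T\in\mathrm{Sp}(V_A)$, $F_T=\ker(T-\mathrm{id})\leq V_A$ and $\widehat{F_T}=\mathrm{Hom}(F_T,U(1))$. $\mathcal{X}_A=\{(T,\ell):T\in\mathrm{Sp}(V_A),\ \ell\in\widehat{F_T}\}$, with $\mathrm{Sp}(V_A)$ acting by $S\cdot(T,\ell)=(STS^{-1},\ell\circ S^{-1})$. *)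

(* Defs.v *)
From HB Require Import structures.
From mathcomp Require Import all_boot all_order all_algebra.
From mathcomp Require Import boolp classical_sets functions reals complex.

Set Implicit Arguments.
Unset Strict Implicit.
Unset Printing Implicit Defensive.

Import Order.TTheory GRing.Theory Num.Theory.

Local Open Scope ring_scope.

Section Circle.
Variable R : realType.

Record U1 := MkU1 { u1val : R[i]; _ : `|u1val| == 1 }.

HB.instance Definition _ := [isSub for u1val].
HB.instance Definition _ := [Choice of U1 by <:].

Lemma u1_norm (z : U1) : `|u1val z| = 1.
Proof. exact/eqP/(valP z). Qed.

Lemma u1_neq0 (z : U1) : u1val z != 0.
Proof. by rewrite -normr_eq0 u1_norm oner_neq0. Qed.

Lemma u1_one_subproof : `|1 : R[i]| == 1.
Proof. by rewrite normr1. Qed.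

Lemma u1_mul_subproof (z w : U1) : `|u1val z * u1val w| == 1.
Proof. by rewrite normrM !u1_norm mulr1. Qed.

Lemma u1_inv_subproof (z : U1) : `|(u1val z)^-1| == 1.
Proof. by rewrite normfV u1_norm invr1. Qed.

Definition u1_one := MkU1 u1_one_subproof.
Definition u1_mul z w := MkU1 (u1_mul_subproof z w).
Definition u1_inv z := MkU1 (u1_inv_subproof z).

Fact u1_mulA : associative u1_mul.
Proof. by move=> x y z; apply: val_inj; rewrite /= mulrA. Qed.
Fact u1_mul1g : left_id u1_one u1_mul.
Proof. by move=> x; apply: val_inj; rewrite /= mul1r. Qed.
Fact u1_mulg1 : right_id u1_one u1_mul.
Proof. by move=> x; apply: val_inj; rewrite /= mulr1. Qed.
Fact u1_mulVg : left_inverse u1_one u1_inv u1_mul.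
Proof. by move=> x; apply: val_inj; rewrite /= mulVf ?u1_neq0. Qed.
Fact u1_mulgV : right_inverse u1_one u1_inv u1_mul.
Proof. by move=> x; apply: val_inj; rewrite /= divff ?u1_neq0. Qed.

HB.instance Definition _ := isGroup.Build U1
  u1_mulA u1_mul1g u1_mulg1 u1_mulVg u1_mulgV.

Lemma u1_mulC (z w : U1) : (z * w = w * z)%g.
Proof. by apply: val_inj; rewrite /= mulrC. Qed.

Lemma u1_mulACA (x y z w : U1) : (x * y * (z * w) = x * z * (y * w))%g.
Proof. by rewrite -!mulgA (mulgA y) (u1_mulC y z) -(mulgA z). Qed.

Lemma u1_invM (x y : U1) : ((x * y)^-1 = x^-1 * y^-1)%g.
Proof. by rewrite invgM u1_mulC. Qed.

End Circle.

(* Hom(G, U(1)), written additively. *)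
Section Dual.
Variables (R : realType) (G : zmodType).

Definition is_character (f : G -> U1 R) : Prop :=
  forall a b, f (a + b) = (f a * f b)%g.

Record dual := Dual { dual_fun :> G -> U1 R; dualP : is_character dual_fun }.

HB.instance Definition _ := gen_eqMixin dual.
HB.instance Definition _ := gen_choiceMixin dual.

Lemma dual_eq (f g : dual) : f =1 g -> f = g.
Proof.
case: f g => [f fP] [g gP] /= /funext fg; rewrite -{}fg in gP *.
by rewrite (Prop_irrelevance fP gP).
Qed.

Lemma dual0_subproof : is_character (fun _ => 1%g).
Proof. by move=> a b; rewrite mulg1. Qed.
Definition dual0 := Dual dual0_subproof.

Lemma dualD_subproof (f g : dual) : is_character (fun a => f a * g a)%g.
Proof. by move=> a b; rewrite !dualP u1_mulACA. Qed.
Definition dualD f g := Dual (dualD_subproof f g).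

Lemma dualN_subproof (f : dual) : is_character (fun a => (f a)^-1)%g.
Proof. by move=> a b; rewrite dualP u1_invM. Qed.
Definition dualN f := Dual (dualN_subproof f).

Fact dualDA : associative dualD.
Proof. by move=> f g h; apply: dual_eq => a /=; rewrite mulgA. Qed.
Fact dualDC : commutative dualD.
Proof. by move=> f g; apply: dual_eq => a /=; rewrite u1_mulC. Qed.
Fact dual0D : left_id dual0 dualD.
Proof. by move=> f; apply: dual_eq => a /=; rewrite mul1g. Qed.
Fact dualND : left_inverse dual0 dualN dualD.
Proof. by move=> f; apply: dual_eq => a /=; rewrite mulVg. Qed.

HB.instance Definition _ :=
  GRing.isZmodule.Build dual dualDA dualDC dual0D dualND.

End Dual.

(* The product of Aut(V) is T * S = T \o S, contrary to the convention of    *)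
(* {perm _}.                                                                 *)
Section Aut.
Variable V : zmodType.

Record aut := MkAut {
  aut_fun :> V -> V;
  aut_inv : V -> V;
  aut_add : {morph aut_fun : u v / u + v};
  autK : cancel aut_fun aut_inv;
  autVK : cancel aut_inv aut_fun }.

HB.instance Definition _ := gen_eqMixin aut.
HB.instance Definition _ := gen_choiceMixin aut.

Lemma aut_eq (T S : aut) : T =1 S -> T = S.
Proof.
case: T S => [T T' TD TK TVK] [S S' SD SK SVK] /= /funext TS.
rewrite -{}TS in SD SK SVK *.
have /funext TS' : T' =1 S' by move=> u; rewrite -{1}[u]SVK TK.
rewrite -{}TS' in SK SVK *.
by rewrite (Prop_irrelevance TD SD) (Prop_irrelevance TK SK)
           (Prop_irrelevance TVK SVK).
Qed.

Fact aut_zmod_morphism (T : aut) : zmod_morphism T.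
Proof.
have TN v : T (- v) = - T v.
  apply: (@addIr _ (T v)); rewrite -aut_add !addNr.
  by apply: (@addIr _ (T 0)); rewrite -aut_add !add0r.
by move=> u v; rewrite aut_add TN.
Qed.
HB.instance Definition _ (T : aut) :=
  GRing.isZmodMorphism.Build V V T (aut_zmod_morphism T).

Definition aut1 : aut := @MkAut idfun idfun
  (fun _ _ => erefl) (fun _ => erefl) (fun _ => erefl).

Fact autM_add (T S : aut) : {morph T \o S : u v / u + v}.
Proof. by move=> u v; rewrite /= !aut_add. Qed.
Definition autM (T S : aut) : aut := MkAut (autM_add T S)
  (can_comp (@autK T) (@autK S)) (can_comp (@autVK S) (@autVK T)).

Fact autV_add (T : aut) : {morph aut_inv T : u v / u + v}.
Proof. by move=> u v; rewrite -{1}[u](autVK T) -{1}[v](autVK T) -aut_add autK. Qed.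
Definition autV (T : aut) : aut := MkAut (autV_add T) (@autVK T) (@autK T).

Fact autMA : associative autM.
Proof. by move=> T S U; apply: aut_eq. Qed.
Fact aut1M : left_id aut1 autM.
Proof. by move=> T; apply: aut_eq. Qed.
Fact autM1 : right_id aut1 autM.
Proof. by move=> T; apply: aut_eq. Qed.
Fact autVM : left_inverse aut1 autV autM.
Proof. by move=> T; apply: aut_eq => u /=; rewrite autK. Qed.
Fact autMV : right_inverse aut1 autV autM.
Proof. by move=> T; apply: aut_eq => u /=; rewrite autVK. Qed.

HB.instance Definition _ := isGroup.Build aut autMA aut1M autM1 autVM autMV.

Lemma autME (T S : aut) u : (T * S)%g u = T (S u). Proof. by []. Qed.
Lemma aut1E u : (1 : aut)%g u = u. Proof. by []. Qed.
Lemma autVKE (T : aut) u : T (T^-1%g u) = u. Proof. exact: autVK. Qed.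
Lemma autKE (T : aut) u : T^-1%g (T u) = u. Proof. exact: autK. Qed.

(* fixsub T is the group F_T = ker (T - id), as a type. *)
Definition fixpred (T : aut) : {pred V} := [pred u | T u - u == 0].

Fact fixpred_zmod (T : aut) : zmod_closed (fixpred T).
Proof.
split=> [|u v]; first by rewrite inE [T 0]raddf0 subrr.
rewrite !inE !subr_eq0 => /eqP Tu /eqP Tv.
by rewrite aut_zmod_morphism Tu Tv.
Qed.
HB.instance Definition _ (T : aut) :=
  GRing.isZmodClosed.Build V (fixpred T) (fixpred_zmod T).

Record fixsub (T : aut) := FixSub { fixval :> V; _ : fixval \in fixpred T }.
HB.instance Definition _ (T : aut) := [isSub for @fixval T].
HB.instance Definition _ (T : aut) := [Choice of fixsub T by <:].
HB.instance Definition _ (T : aut) := [SubChoice_isSubZmodule of fixsub T by <:].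

Lemma fixpredP (T : aut) u : reflect (T u = u) (u \in fixpred T).
Proof. by rewrite inE subr_eq0; apply: eqP. Qed.

End Aut.

Section Clifford.
Variables (R : realType) (A : finZmodType).

Definition phase_space : zmodType := (A * dual R A)%type.
Local Notation V := phase_space.

Definition beta (u v : V) : U1 R := u.2 v.1.
Definition omega (u v : V) : U1 R := (beta u v * (beta v u)^-1)%g.

Definition symplectic : {pred aut V} :=
  fun T => `[< forall u v, omega (T u) (T v) = omega u v >].

Lemma symplecticP (T : aut V) :
  reflect (forall u v, omega (T u) (T v) = omega u v) (T \in symplectic).
Proof. exact: asboolP. Qed.

Fact symplectic_group_closed : group_closed symplectic.
Proof.
split; first exact/symplecticP.
move=> T S /symplecticP TP /symplecticP SP; apply/symplecticP => u v.
by rewrite !autME TP -SP !autVKE.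
Qed.

Record Sp := MkSp { sp_val :> aut V; sp_valP : sp_val \in symplectic }.
HB.instance Definition _ := [isSub for sp_val].
HB.instance Definition _ := [Choice of Sp by <:].
HB.instance Definition _ :=
  SubChoice_isSubGroup.Build _ _ Sp symplectic_group_closed.

(* The projective Clifford group C(A), in its description by pairs:          *)
(* (T, lambda) stands for the class, modulo scalars, of the unitaries U      *)
(* of C[A] such that U W_u U^* = lambda(u) W_(T u) for all u, where          *)
(* W_(a, chi) |b> = chi(b) |a + b>. Membership of T in Sp is a consequence   *)
(* of the cocycle equation (cliff_symplectic below).                         *)
Record clifford := MkClifford {
  cliff_aut : aut V;
  cliff_phase : V -> U1 R;
  cliffP : forall u v,
    (cliff_phase (u + v)%R * (cliff_phase u)^-1 * (cliff_phase v)^-1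
     = beta (cliff_aut u) (cliff_aut v) * (beta u v)^-1)%g }.

HB.instance Definition _ := gen_eqMixin clifford.
HB.instance Definition _ := gen_choiceMixin clifford.

Lemma clifford_eq (g h : clifford) :
  cliff_aut g =1 cliff_aut h -> cliff_phase g =1 cliff_phase h -> g = h.
Proof.
case: g h => [T l gP] [S m hP] /= /aut_eq TS /funext lm.
by rewrite -{}TS -{}lm in hP *; rewrite (Prop_irrelevance gP hP).
Qed.

Fact cliff1P (u v : V) :
  ((1 : U1 R) * 1^-1 * 1^-1
   = beta ((1 : aut V)%g u) ((1 : aut V)%g v) * (beta u v)^-1)%g.
Proof. by rewrite !aut1E !mulgV. Qed.
Definition cliff1 := MkClifford cliff1P.

Fact cliffM_P (g h : clifford) (T := cliff_aut g) (S := cliff_aut h)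
    (l := fun u => (cliff_phase g (S u) * cliff_phase h u)%g) (u v : V) :
  (l (u + v)%R * (l u)^-1 * (l v)^-1
   = beta ((T * S)%g u) ((T * S)%g v) * (beta u v)^-1)%g.
Proof.
rewrite /l aut_add !u1_invM [X in (X * _)%g = _]u1_mulACA [LHS]u1_mulACA.
rewrite (cliffP g) (cliffP h) !autME mulgA; congr (_ * _)%g.
by rewrite -mulgA mulVg mulg1.
Qed.
Definition cliffM g h := MkClifford (cliffM_P g h).

Fact cliffV_P (g : clifford) (T := (cliff_aut g)^-1%g)
    (l := fun u => ((cliff_phase g (T u))^-1)%g) (u v : V) :
  (l (u + v)%R * (l u)^-1 * (l v)^-1
   = beta (T u) (T v) * (beta u v)^-1)%g.
Proof.
rewrite /l aut_add -!u1_invM cliffP !autVKE.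
by rewrite u1_invM invgK u1_mulC.
Qed.
Definition cliffV g := MkClifford (cliffV_P g).

Fact cliffMA : associative cliffM.
Proof. by move=> g h k; apply: clifford_eq => u //=; rewrite mulgA. Qed.
Fact cliff1M : left_id cliff1 cliffM.
Proof. by move=> g; apply: clifford_eq => u //=; rewrite mul1g. Qed.
Fact cliffM1 : right_id cliff1 cliffM.
Proof. by move=> g; apply: clifford_eq => u //=; rewrite mulg1. Qed.
Fact cliffVM : left_inverse cliff1 cliffV cliffM.
Proof.
by move=> g; apply: clifford_eq => u /=; rewrite autK ?mulVg.
Qed.
Fact cliffMV : right_inverse cliff1 cliffV cliffM.
Proof.
by move=> g; apply: clifford_eq => u /=; rewrite ?autVKE ?mulgV.
Qed.

HB.instance Definition _ := isGroup.Build clifford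
  cliffMA cliff1M cliffM1 cliffVM cliffMV.

Lemma cliff_symplectic (g : clifford) : cliff_aut g \in symplectic.
Proof.
apply/symplecticP => u v; rewrite /omega.
have E : (beta (cliff_aut g u) (cliff_aut g v) * (beta u v)^-1
    = beta (cliff_aut g v) (cliff_aut g u) * (beta v u)^-1)%g.
  by rewrite -!cliffP addrC -mulgA [X in (_ * X)%g]u1_mulC mulgA.
move: (beta u v) (beta v u) (beta (_ u) _) (beta (_ v) _) E => b d a c E.
rewrite -[a](mulgVK b) E -mulgA.
rewrite (u1_mulC c) (u1_mulC b c^-1%g) mulgA mulgK.
exact: u1_mulC.
Qed.
Definition cliff_sp (g : clifford) : Sp := MkSp (cliff_symplectic g).

Definition cliff_res (g : clifford) (u : fixsub (cliff_sp g)) : U1 R :=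
  cliff_phase g (fixval u).

(* The set X_A of pairs (T, l), l being a character of F_T. *)
Record fixpair := FixPair { fp_sp : Sp; fp_char : dual R (fixsub fp_sp) }.

Fact conj_fix (S T : Sp) (u : fixsub (S * T * S^-1)%g) :
  (S : aut V)^-1%g (fixval u) \in fixpred T.
Proof.
case: u => u /= /fixpredP uP; apply/fixpredP.
by rewrite -[in RHS]uP [RHS]autKE.
Qed.

Definition conj_fixsub (S T : Sp) (u : fixsub (S * T * S^-1)%g) : fixsub T :=
  FixSub (conj_fix u).

Fact sp_act_character (S : Sp) (x : fixpair) :
  is_character (fun u => fp_char x (@conj_fixsub S (fp_sp x) u)).
Proof.
move=> u v; rewrite -dualP; congr (fp_char x _).
apply: val_inj; exact: (aut_add (sp_val S)^-1%g (fixval u) (fixval v)).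
Qed.

Definition sp_act (S : Sp) (x : fixpair) : fixpair :=
  FixPair (Dual (@sp_act_character S x)).

Lemma fixpair_eq (x y : fixpair) :
    fp_sp x =1 fp_sp y ->
    (forall u v, fixval u = fixval v -> fp_char x u = fp_char y v) ->
  x = y.
Proof.
case: x y => [T l] [S m] /= /aut_eq /val_inj TS.
by case: S / TS m => m lm; congr FixPair; apply: dual_eq => u; apply: lm.
Qed.

Lemma sp_act1 x : sp_act 1%g x = x.
Proof.
apply: fixpair_eq => // u v uv /=.
by congr (fp_char x _); apply: val_inj.
Qed.

Lemma sp_actM S T x : sp_act (S * T)%g x = sp_act S (sp_act T x).
Proof.
apply: fixpair_eq => // u v uv /=.
congr (fp_char x _); apply: val_inj => /=; rewrite uv //.
Qed.

Definition conj_class (g : clifford) : set clifford :=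
  [set h | exists k : clifford, h = (k * g * k^-1)%g].

Definition sp_orbit (x : fixpair) : set fixpair :=
  [set y | exists S : Sp, y = sp_act S x].

Definition conj_classes : set (set clifford) := range conj_class.

Definition sp_orbits : set (set fixpair) := range sp_orbit.

End Clifford.

(* Main.v *)
Require Import Defs.
From HB Require Import structures.
From mathcomp Require Import all_boot all_order all_algebra.
From mathcomp Require Import boolp classical_sets functions reals complex.

Set Implicit Arguments.
Unset Strict Implicit.
Unset Printing Implicit Defensive.

Import Order.TTheory GRing.Theory Num.Theory.

Local Open Scope ring_scope.
Local Open Scope classical_set_scope.

(** Why the theorem is true.  Write the phases additively.  For a pair
    g = (T, lambda) the defining equation says that the coboundary of lambda
    is the cocycle c_T (u, v) = beta (T u, T v) - beta (u, v).  On F_T this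
    cocycle vanishes, so lambda restricts to a character l of F_T.
    Conjugating g by (S, mu) replaces T by S T S^-1 and, at a fixed vector of
    S T S^-1, the two contributions of mu cancel; hence the class of g
    determines the orbit of (T, l).

    Both directions of the bijection then rest on the fact that U(1) is
    divisible, hence injective as an abelian group ([circle_divisible],
    [divisible_injective]).

    Surjectivity ([res_pair_surj]): T being symplectic means exactly that c_T
    is symmetric, so c_T defines an abelian extension of V by U(1); injectivity
    of U(1) splits it, that is, c_T is the coboundary of some lambda, which can
    moreover be corrected by a character of V so as to restrict to a prescribed
    character of F_T ([symmetric_cocycle_splits_extending]).  In particular
    every symplectic S lifts to a pair, so the orbit of (T, l) is the full image
    of the conjugacy class ([image_conj_class]).

    Injectivity ([res_pair_inj_conj]): if (T, lambda) and (T, lambda') agree on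
    F_T, then chi = lambda' - lambda is a character of V that vanishes on the
    kernel of T - 1.  Hence chi = m o (T - 1) for a character m of V, again by
    injectivity of U(1), and this equation says precisely that the pair (1, m)
    conjugates the first pair into the second. *)

(** * Divisible abelian groups are injective *)

Definition divisible (D : zmodType) : Prop :=
  forall (n : nat) (d : D), (0 < n)%N -> exists e, e *+ n = d.

Section Injectivity.
Variables (V D : zmodType).

(** The graph of a morphism from a subgroup of [V] to [D]: a subgroup of
    [V * D] that meets [0 * D] trivially.  Working with graphs avoids subgroup
    types that would grow along a chain, and makes a union of a chain
    a plain union of sets. *)
Definition partial_morphism (G : set (V * D)) : Prop :=
  [/\ G 0, forall p q, G p -> G q -> G (p - q)
    & forall d, G (0, d) -> d = 0].

Section OneStep.
Variables (G : set (V * D)) (GP : partial_morphism G).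

Lemma partial_morphism_inj v d e : G (v, d) -> G (v, e) -> d = e.
Proof.
case: GP => _ GB Gf Gd Ge; apply/eqP; rewrite -subr_eq0; apply/eqP/Gf.
by have := GB _ _ Gd Ge; rewrite /GRing.add /= /add_pair /= subrr.
Qed.

Lemma partial_morphismN p : G p -> G (- p).
Proof. by case: GP => G0 GB _ Gp; rewrite -[- p]add0r; apply: GB. Qed.

Lemma partial_morphismMz p n : G p -> G (p *~ n).
Proof.
case: GP => G0 GB _ Gp.
have GMn m : G (p *+ m).
  elim: m => [|m IH]; first by rewrite mulr0n.
  by rewrite mulrSr -[X in _ + X]opprK; apply/GB/partial_morphismN.
by case: n => m; [apply: GMn | apply/partial_morphismN/GMn].
Qed.

Lemma pairMz (x : V) (w : D) n : (x, w) *~ n = (x *~ n, w *~ n).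
Proof.
rewrite [LHS]surjective_pairing.
by rewrite (raddfMz (@fst V D : {additive _ -> _}))
           (raddfMz (@snd V D : {additive _ -> _})).
Qed.

(** The multipliers n with n x in the domain of [G] form an ideal of the
    integers.  If its positive generator is k, divisibility provides a k-th
    part w of the value at k x, and w is then compatible with every multiplier;
    if the ideal is zero, any w will do. *)
Lemma compatible_value (divD : divisible D) (x : V) :
  exists w : D, forall n e, G (x *~ n, e) -> e = w *~ n.
Proof.
have GMz n e m : G (x *~ n, e) -> G (x *~ (n * m), e *~ m).
  by move=> /(@partial_morphismMz _ m); rewrite pairMz mulrzA.
pose P k := (0 < k)%N && `[< exists e, G (x *+ k, e) >].
have absP n e : n != 0 -> G (x *~ n, e) -> P `|n|%N.
  move=> n0 Ge; rewrite /P absz_gt0 n0; apply/asboolP.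
  exists (e *~ sgz n); have := GMz _ _ (sgz n) Ge.
  by rewrite mulrC -abszEsg.
have [exP|noP] := pselect (exists k, P k); last first.
  exists 0 => n e Ge; rewrite mul0rz.
  have [n0|n0] := eqVneq n 0; last by case: noP; exists `|n|%N; apply: absP Ge.
  by case: GP => _ _; apply; move: Ge; rewrite n0 mulr0z.
case: (ex_minnP exP) => k /andP[k0 /asboolP[d Gd]] kmin.
have [w wk] := divD k d k0; exists w => n e Ge.
suff nE : n = k%:Z * (n %/ k)%Z.
  apply: (partial_morphism_inj Ge).
  have -> : w *~ n = d *~ (n %/ k)%Z by rewrite -wk pmulrn -mulrzA -nE.
  by rewrite {1}nE; apply: (GMz k%:Z d).
rewrite mulrC {1}(divz_eq n k); suff -> : (n %% k)%Z = 0 by rewrite addr0.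
have [//|r0] := eqVneq (n %% k)%Z 0; exfalso.
suff /kmin : P `|(n %% k)%Z|%N.
  by rewrite leqNgt -ltz_nat gez0_abs ?modz_ge0 ?ltz_pmod // gt_eqF.
apply: (absP _ (e - d *~ (n %/ k)%Z)) => //.
case: GP => _ GB _; have := GB _ _ Ge (GMz k%:Z d (n %/ k)%Z Gd).
rewrite {1}[n](divz_eq n k) mulrzDr mulrC.
by rewrite [X in G X]/GRing.add /= /add_pair /= addrC addKr.
Qed.

Lemma partial_morphism_step (divD : divisible D) (x : V) :
  exists2 G', partial_morphism G' & G `<=` G' /\ exists d, G' (x, d).
Proof.
have [w wP] := compatible_value divD x; case: GP => G0 GB Gf.
exists [set p | exists n, G (p - (x, w) *~ n)]; last split.
- split=> /=.
  + by exists 0; rewrite mulr0z subr0.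
  + move=> p q [m Gp] [n Gq]; exists (m - n).
    rewrite mulrzBr; set a := _ *~ m; set b := _ *~ n.
    suff -> : p - q - (a - b) = p - a - (q - b) by apply: GB.
    by rewrite !opprB addrACA [RHS]addrACA [- q - a]addrC.
  + move=> d [n].
    rewrite pairMz => /partial_morphismN; rewrite opprB.
    rewrite [X in G X]/GRing.add /= /add_pair /= oppr0 addr0 => /wP/eqP.
    by rewrite eq_sym -subr_eq0 opprB addrCA subrr addr0 => /eqP.
- by move=> p Gp /=; exists 0; rewrite mulr0z subr0.
- by exists w => /=; exists 1; rewrite mulr1z subrr.
Qed.

End OneStep.

(** A maximal graph above [G0] has full domain, since otherwise one more vector
    could be adjoined. *)
Lemma partial_morphism_total (divD : divisible D) (G0 : set (V * D)) :
    partial_morphism G0 ->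
  exists2 G, partial_morphism G & G0 `<=` G /\ forall x, exists d, G (x, d).
Proof.
move=> G0P.
(* Zorn_bigcup also asks for the union of the empty chain, hence the proviso
   that the graph be nonempty. *)
pose P (G : set (V * D)) := G !=set0 -> partial_morphism G /\ G0 `<=` G.
have [F FP Ftot|G [GP Gmax]] := @Zorn_bigcup _ P.
  case=> p [X FX Xp].
  have XP Y q : F Y -> Y q -> partial_morphism Y /\ G0 `<=` Y.
    by move=> FY Yq; apply: (FP _ FY); exists q.
  have [XPM G0X] := XP _ _ FX Xp.
  split; last by move=> q /G0X Xq; exists X.
  split; first by exists X => //; case: XPM.
  - move=> q r [Y FY Yq] [Z FZ Zr].
    have [[_ YB _] _] := XP _ _ FY Yq; have [[_ ZB _] _] := XP _ _ FZ Zr.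
    have [YZ|ZY] := Ftot _ _ FY FZ.
    + by exists Z => //; apply: ZB => //; apply: YZ.
    + by exists Y => //; apply: YB => //; apply: ZY.
  - by move=> d [Y FY Yd]; have [[_ _ Yf] _] := XP _ _ FY Yd; apply: Yf.
have maxE G' : partial_morphism G' -> G0 `<=` G' -> G `<=` G' -> G' `<=` G.
  move=> G'P G0G' GG'; apply: contrapT => nG'G.
  by apply: (Gmax G') => [|_ //]; split.
have [Gn0|/nonemptyPn GE] := pselect (G !=set0); last first.
  have G00 : G0 0 by case: G0P.
  suff : G 0 by rewrite GE.
  by apply: (maxE G0) => //; rewrite GE; apply: sub0set.
have [{}GP G0G] := GP Gn0; exists G => //; split=> // x.
have [G' G'P [GG' [d G'd]]] := partial_morphism_step GP divD x.
by exists d; apply: (maxE G') => //; apply: subset_trans GG'.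
Qed.

(** Stated for an arbitrary [i] with a condition on kernels rather than for an
    injection, so that it also yields factorizations through an endomorphism
    that is not injective, such as T - 1. *)
Lemma divisible_injective (divD : divisible D) (W : zmodType)
    (i : {additive W -> V}) (f : {additive W -> D}) :
    (forall w, i w = 0 -> f w = 0) ->
  exists g : {additive V -> D}, forall w, g (i w) = f w.
Proof.
move=> ker_if; pose G0 := range (fun w => (i w, f w)).
have G0P : partial_morphism G0.
  split; first by exists 0; rewrite // !raddf0.
    by move=> _ _ [u _ <-] [v _ <-]; exists (u - v); rewrite // !raddfB.
  by move=> d [w _ [/ker_if fw0 <-]].
have [G GP [G0G /choice[g gP]]] := partial_morphism_total divD G0P.
have gB : zmod_morphism g.
  move=> u v; apply: (partial_morphism_inj GP (gP _)).
  by case: GP => _ GB _; apply: (GB (u, g u) (v, g v)).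
pose gM := GRing.isZmodMorphism.Build V D g gB.
pose ga : {additive V -> D} := HB.pack g gM.
exists ga => w; apply: (partial_morphism_inj GP (gP _)).
by apply: G0G; exists w.
Qed.

End Injectivity.

(** * Symmetric cocycles with values in a divisible group are coboundaries *)
Section CocycleExtension.
Variables (V D : zmodType) (c : V -> V -> D).
Hypothesis cC : forall u v, c u v = c v u.
Hypothesis cA : forall u v w, c u v + c (u + v) w = c v w + c u (v + w).

(** The extension of [V] by [D] with cocycle [c].  As [c] need not be
    normalized, the neutral element is [(- c 0 0, 0)], and [D] embeds by
    [d |-> (d - c 0 0, 0)]. *)
Definition cocycle_ext : Type := (D * V)%type.
HB.instance Definition _ := Choice.copy cocycle_ext (D * V)%type.

Let cx0 : cocycle_ext := (- c 0 0, 0).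
Let cxD (p q : cocycle_ext) : cocycle_ext :=
  (p.1 + q.1 + c p.2 q.2, p.2 + q.2).
Let cxN (p : cocycle_ext) : cocycle_ext :=
  (- p.1 - c 0 0 - c p.2 (- p.2), - p.2).

Lemma cocycle0 v : c 0 v = c 0 0.
Proof. by have := cA 0 0 v; rewrite !add0r => /addIr. Qed.

Fact cxDA : associative cxD.
Proof.
move=> p q r; congr (_, _) => /=; last exact: addrA.
by rewrite -!addrA; congr (_ + (_ + _)); rewrite [RHS]addrCA -cA.
Qed.

Fact cxDC : commutative cxD.
Proof. by move=> p q; rewrite /cxD cC (addrC q.1) (addrC q.2). Qed.

Fact cx0D : left_id cx0 cxD.
Proof.
by case=> d v; rewrite /cxD /= cocycle0 add0r [- _ + _]addrC addrNK.
Qed.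

Fact cxND : left_inverse cx0 cxN cxD.
Proof.
case=> d v; rewrite /cxD /cx0 /= addNr; congr (_, _).
by rewrite (cC (- v)) addrAC subrK addrAC addNr add0r.
Qed.

HB.instance Definition _ :=
  GRing.isZmodule.Build cocycle_ext cxDA cxDC cx0D cxND.

Definition cocycle_incl (d : D) : cocycle_ext := (d - c 0 0, 0).

Fact cocycle_incl_zmod : zmod_morphism cocycle_incl.
Proof.
move=> d e; apply/eqP; rewrite eq_sym subr_eq; apply/eqP.
by congr (_, _); rewrite /= ?addr0 // addrA subrK addrAC subrK.
Qed.
HB.instance Definition _ :=
  GRing.isZmodMorphism.Build D cocycle_ext cocycle_incl cocycle_incl_zmod.

(** Symmetry of [c] makes the extension abelian, so that the identity of [D]
    extends to a retraction g of the extension onto [D]; the failure of the set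
    section u |-> (0, u) to be additive is [c], so - g (0, u) has coboundary
    [c]. *)
Lemma symmetric_cocycle_splits (divD : divisible D) :
  exists l : V -> D, forall u v, l (u + v) = c u v + l u + l v.
Proof.
have kerI d : cocycle_incl d = 0 -> @idfun D d = 0.
  by case=> /(canRL (subrK _)); rewrite addNr.
have [g gP] := divisible_injective divD kerI.
pose s (u : V) : cocycle_ext := (0, u).
exists (fun u => - g (s u)) => u v.
have -> : s (u + v) = s u + s v - cocycle_incl (c u v).
  apply/eqP; rewrite eq_sym subr_eq; apply/eqP; congr (_, _) => /=.
    by rewrite !add0r (cC (u + v)) cocycle0 subrK.
  by rewrite addr0.
by rewrite [g _]raddfB gP [g _]raddfD opprB opprD addrA.
Qed.

(** Two solutions of the coboundary equation on [W] differ by a morphism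
    [W -> D]; extending this morphism to [V] corrects any solution on [V] into
    one with the prescribed restriction. *)
Lemma symmetric_cocycle_splits_extending (divD : divisible D)
    (W : zmodType) (i : {additive W -> V}) (m : W -> D) :
    injective i -> (forall u v, m (u + v) = c (i u) (i v) + m u + m v) ->
  exists2 l : V -> D, forall u v, l (u + v) = c u v + l u + l v
                    & forall w, l (i w) = m w.
Proof.
move=> i_inj mD; have [l lD] := symmetric_cocycle_splits divD.
pose f w := m w - l (i w).
have fB : zmod_morphism f.
  have fD u v : f (u + v) = f u + f v.
    rewrite /f raddfD mD lD -[_ + m u + _]addrA -[_ + l (i u) + _]addrA.
    rewrite opprD addrACA subrr add0r.
    by rewrite opprD addrACA.
  by move=> u v; apply/eqP; rewrite eq_sym subr_eq -fD subrK.
pose fM := GRing.isZmodMorphism.Build W D f fB.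
pose fa : {additive W -> D} := HB.pack f fM.
have ker_i w : i w = 0 -> fa w = 0.
  move=> iw0; have -> : w = 0 by apply: i_inj; rewrite iw0 raddf0.
  exact: raddf0.
have [g gP] := divisible_injective divD ker_i.
exists (fun u => l u + g u) => [u v|w]; last by rewrite gP /= /f addrC subrK.
by rewrite lD raddfD -!addrA; congr (_ + (_ + _)); rewrite addrCA.
Qed.

End CocycleExtension.

(** * The circle group is divisible *)

(** U(1) with its law written additively: a separate name is needed because
    [U1 R] carries the multiplicative structure. *)
Definition circle (R : realType) : Type := U1 R.

Section Circle.
Variable R : realType.

HB.instance Definition _ := Choice.copy (circle R) (U1 R).
HB.instance Definition _ := GRing.isZmodule.Build (circle R)
  (@u1_mulA R) (@u1_mulC R) (@u1_mul1g R) (@u1_mulVg R).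

Lemma u1val_mulrn (z : circle R) n : u1val (z *+ n) = u1val z ^+ n.
Proof. by elim: n => [//|n IH]; rewrite mulrS exprS -IH. Qed.

Lemma circle_divisible : divisible (circle R).
Proof.
move=> n z n0; pose w := n.-root (u1val z : R[i]).
have wn : w ^+ n = u1val z by rewrite rootCK.
have w1 : `|w| == 1.
  by rewrite -(@pexpr_eq1 _ _ n) -?normrX ?wn ?u1_norm ?eqxx.
by exists (MkU1 w1); apply: val_inj; rewrite /= u1val_mulrn.
Qed.

End Circle.

(** * Clifford pairs and their restrictions to fixed vectors *)

Section Classes.
Variables (R : realType) (A : finZmodType).
Local Notation V := (phase_space R A).
Local Notation clifford := (clifford R A).
Local Notation fixpair := (fixpair R A).

(** On fixed vectors of T the right-hand side of the defining equation of the
    phase is trivial. *)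
Lemma cliff_res_character (g : clifford) : is_character (@cliff_res R A g).
Proof.
move=> u v; have := cliffP g (fixval u) (fixval v).
case: u v => [u gu] [v gv]; rewrite /cliff_res /=.
move/fixpredP: gu => ->; move/fixpredP: gv => ->; rewrite mulgV => E.
apply: (mulIg (cliff_phase g v)^-1%g); rewrite mulgK.
by apply: (mulIg (cliff_phase g u)^-1%g); rewrite mulgV -[RHS]E -!mulgA
  [X in (_ * X)%g]u1_mulC.
Qed.

Definition res_pair (g : clifford) : fixpair :=
  FixPair (Dual (@cliff_res_character g)).

(** Equality of the pairs is equality in a dependent record; this extracts its
    content in terms of vectors, without transport between types [fixsub]. *)
Lemma res_pair_eqE (g h : clifford) : res_pair g = res_pair h ->
  cliff_aut g = cliff_aut h /\
  forall u, cliff_aut g u = u -> cliff_phase g u = cliff_phase h u.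
Proof.
have charE (x y : fixpair) : x = y -> forall u v,
    fixval u = fixval v -> fp_char x u = fp_char y v.
  by move=> -> u v uv; congr (fp_char _ _); apply: val_inj.
move=> gh; have ghE : cliff_aut g = cliff_aut h.
  by rewrite -[LHS]/(fp_sp (res_pair g) : aut V) gh.
split=> // u gu.
have ug : u \in fixpred (cliff_sp g) by apply/fixpredP.
have uh : u \in fixpred (cliff_sp h) by apply/fixpredP; rewrite /= -ghE.
exact: (charE _ _ gh (FixSub ug) (FixSub uh)).
Qed.

Definition form (u v : V) : circle R := beta u v.

Definition form_defect (T : aut V) (u v : V) : circle R :=
  form (T u) (T v) - form u v.

Definition phase (g : clifford) : V -> circle R := cliff_phase g.

Lemma phaseD (g : clifford) u v :
  phase g (u + v) = form_defect (cliff_aut g) u v + phase g u + phase g v.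
Proof.
have gP : phase g (u + v) - phase g u - phase g v
          = form_defect (cliff_aut g) u v by exact: cliffP.
by rewrite -gP addrAC subrK subrK.
Qed.

Lemma form_defectDl T u v w :
  form_defect T (u + v) w = form_defect T u w + form_defect T v w.
Proof.
have formDl x y z : form (x + y) z = form x z + form y z by [].
by rewrite /form_defect aut_add !formDl opprD addrACA.
Qed.

Lemma form_defectDr T u v w :
  form_defect T u (v + w) = form_defect T u v + form_defect T u w.
Proof.
have formDr x y z : form x (y + z) = form x y + form x z by exact: dualP.
by rewrite /form_defect aut_add !formDr opprD addrACA.
Qed.

(** Symmetry of the defect of [T] is a rearrangement of the invariance of
    [omega] under [T]. *)
Lemma form_defectC (T : Sp R A) u v : form_defect T u v = form_defect T v u.
Proof.
have TP : form (sp_val T u) (sp_val T v) - form (sp_val T v) (sp_val T u)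
          = form u v - form v u by exact: (symplecticP _ (sp_valP T)).
rewrite /form_defect (canRL (subrK _) TP).
by apply/eqP; rewrite subr_eq addrC addrCA addrC.
Qed.

(** The defect is additive in each variable, and any biadditive map is
    a cocycle. *)
Lemma form_defect_cocycle T u v w :
  form_defect T u v + form_defect T (u + v) w
  = form_defect T v w + form_defect T u (v + w).
Proof. by rewrite form_defectDl form_defectDr addrA addrC. Qed.

(** The restriction to F_T of a phase above T has coboundary [form_defect T],
    which is zero there, so a character of F_T is an admissible boundary
    condition for the splitting of the defect. *)
Lemma res_pair_surj (x : fixpair) : exists g, res_pair g = x.
Proof.
case: x => T m.
have [||l lD lm] := @symmetric_cocycle_splits_extending V (circle R)
  (form_defect T) (@form_defectC T) (@form_defect_cocycle T)
  (@circle_divisible R) (fixsub T) (\val : {additive fixsub T -> V}) m.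
- exact: val_inj.
- move=> u v; rewrite /form_defect.
  have fixE (w : fixsub T) : sp_val T (\val w) = \val w.
    by apply/fixpredP/valP.
  by rewrite !fixE subrr add0r; apply: dualP.
have lP u v : (l (u + v)%R * (l u)^-1 * (l v)^-1
     = beta (sp_val T u) (sp_val T v) * (beta u v)^-1)%g.
  suff : l (u + v) - l u - l v = form_defect T u v by [].
  by rewrite lD addrAC addrK addrK.
exists (MkClifford lP); apply: fixpair_eq => //= u v uv.
by rewrite -lm /cliff_res /= uv.
Qed.

(** At u fixed by S T S^-1 put w = S^-1 u.  The phase of the conjugate at u is
    mu (T w) + lambda w - mu w, and T w = w. *)
Lemma res_pair_conj (k g : clifford) :
  res_pair (k * g * k^-1)%g = sp_act (cliff_sp k) (res_pair g).
Proof.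
apply: fixpair_eq => // u v uv; rewrite /= /cliff_res /= uv.
set w := aut_inv _ _.
have -> : cliff_aut g w = w.
  by have /fixpredP := conj_fix v.
by rewrite u1_mulC mulgA mulVg mul1g.
Qed.

(** The conjugating element can be sought above the identity of Sp, as a
    character m of V: it changes the phase of [g] by m o (T - 1), so one has to
    factor the difference of the phases through T - 1. *)
Lemma res_pair_inj_conj (g h : clifford) : res_pair g = res_pair h ->
  exists k, h = (k * g * k^-1)%g.
Proof.
case/res_pair_eqE => ghE gh_fix; set T := cliff_aut g in ghE gh_fix.
pose chi u := phase h u - phase g u.
have chiB : zmod_morphism chi.
  have chiD u v : chi (u + v) = chi u + chi v.
    rewrite /chi !phaseD -ghE -/T -[_ + phase h u + _]addrA.
    rewrite -[_ + phase g u + _]addrA opprD addrACA subrr.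
    by rewrite add0r opprD addrACA.
  by move=> u v; apply/eqP; rewrite eq_sym subr_eq -chiD subrK.
pose chiM := GRing.isZmodMorphism.Build V (circle R) chi chiB.
pose chia : {additive V -> circle R} := HB.pack chi chiM.
pose d u := T u - u.
have dB : zmod_morphism d.
  by move=> u v; rewrite /d raddfB !opprB addrACA [RHS]addrACA [- u - _]addrC.
pose dM := GRing.isZmodMorphism.Build V V d dB.
pose da : {additive V -> V} := HB.pack d dM.
have ker_d u : da u = 0 -> chia u = 0.
  move=> /eqP; rewrite subr_eq0 => /eqP/gh_fix gh.
  by apply/eqP; rewrite subr_eq0; apply/eqP.
have [m mP] := divisible_injective (@circle_divisible R) ker_d.
have kP u v : (m (u + v)%R * (m u)^-1 * (m v)^-1
     = beta ((1 : aut V)%g u) ((1 : aut V)%g v) * (beta u v)^-1)%g.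
  suff : m (u + v) - m u - m v = form u v - form u v by [].
  by rewrite raddfD addrAC addrK !subrr.
exists (MkClifford kP); apply: clifford_eq => u; first by rewrite -ghE.
suff : phase h u = m (T u) + phase g u - m u by [].
by rewrite addrAC -raddfB [m _]mP /= /chi subrK.
Qed.

(** The inclusion of the orbit in the image needs a lift of each symplectic [S]
    to a pair; [res_pair_surj] applied to [S] and the trivial character gives
    one. *)
Lemma image_conj_class (g : clifford) :
  res_pair @` conj_class g = sp_orbit (res_pair g).
Proof.
apply/seteqP; split=> [_ [_ [k ->] <-]|_ [S ->]].
  by exists (cliff_sp k); apply: res_pair_conj.
have [k kS] := res_pair_surj (FixPair (0 : dual R (fixsub S))).
exists (k * g * k^-1)%g; first by exists k.
rewrite res_pair_conj; congr (sp_act _ _).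
by rewrite -[LHS]/(fp_sp (res_pair k)) kS.
Qed.

Lemma conj_class_eq (g h : clifford) :
  conj_class g h -> conj_class g = conj_class h.
Proof.
case=> k ->; apply/seteqP; split=> _ [l ->].
  by exists (l * k^-1)%g; rewrite invgM invgK !mulgA mulgVK mulgVK.
by exists (l * k)%g; rewrite invgM !mulgA.
Qed.

Lemma conj_class_eq_of_orbit (g h : clifford) :
  sp_orbit (res_pair g) = sp_orbit (res_pair h) -> conj_class g = conj_class h.
Proof.
move=> gh; have : sp_orbit (res_pair g) (res_pair h).
  by rewrite gh; exists 1%g; rewrite sp_act1.
rewrite -image_conj_class => -[g' gg' /res_pair_inj_conj g'h].
by rewrite (conj_class_eq gg'); apply: conj_class_eq.
Qed.

End Classes.

(** * The classification *)

Theorem theorem4p3 (R : realType) (A : finZmodType) :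
  exists res_char : forall g : clifford R A, is_character (@cliff_res R A g),
  exists Phi : set (clifford R A) -> set (fixpair R A),
    set_bij (@conj_classes R A) (@sp_orbits R A) Phi /\
    forall g : clifford R A,
      Phi (conj_class g)
      = sp_orbit (@FixPair R A (cliff_sp g) (Dual (res_char g))).
Proof.
exists (@cliff_res_character R A), (image^~ (@res_pair R A)).
split; last exact: image_conj_class.
split=> [_ [g _ <-]|X Y /set_mem[g _ <-] /set_mem[h _ <-]|_ [x _ <-]].
- by rewrite image_conj_class; exists (res_pair g).
- by rewrite !image_conj_class; apply: conj_class_eq_of_orbit.
- have [g <-] := res_pair_surj x.
  by exists (conj_class g); [exists g | apply: image_conj_class].
Qed.
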